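(* Assume the states $\{\omega[t]\}_{t\ge 1}$ are i.i.d., and let $U^{\ast}$ be the optimal value of the deterministic problem of maximizing $h(\mathbf{p})=\mathbb{E}[U(\mathbf{p};\omega[t])]$ over $\mathbf{p}\in\mathcal{P}$ subject to $\sum_{i=1}^n p_i\le \mathbb{E}[e]$. Let $V>0$ and let $\mathbf{p}[t]$, $t\in\{1,2,\ldots\}$, be produced by Algorithm 1 (defined in the context) with parameter $V$. Let $B=(\max\{e^{\max},p^{\max}\})^2$. Then for all $t\in\{1,2,\ldots\}$, $$\frac{1}{t}\sum_{\tau=1}^{t}\mathbb{E}[U(\mathbf{p}[\tau];\omega[\tau])]\ \ge\ U^{\ast}-\frac{V(p^{\max})^2}{2t}-\frac{B}{2Vt}-\frac{D^2+B}{2V}.$$ Consequently, $$\limsup_{t\to\infty}\frac{1}{t}\sum_{\tau=1}^{t}\mathbb{E}[U(\mathbf{p}[\tau];\omega[\tau])]\ \ge\ U^{\ast}-\frac{D^2+B}{2V}.$$ In particular, if $V=1/\epsilon$ with $\epsilon>0$, then $$\frac{1}{t}\sum_{\tau=1}^{t}\mathbb{E}[U(\mathbf{p}[\tau];\omega[\tau])]\ \ge\ U^{\ast}-O(\epsilon)\quad\text{for all } t\ge\Omega(1/\epsilon^2),$$ i.e. there are constants $c,C>0$ depending only on $p^{\max},e^{\max},D$ such that for every $\epsilon>0$, with $V=1/\epsilon$, the average on the left is at least $U^{\ast}-C\epsilon$ for every integer $t\ge \max\{1,c/\epsilon^2\}$.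
   Context: Setting. $n\ge 1$ is an integer and $p^{\max}>0$, $e^{\max}>0$ are constants; $\mathcal{P}=\{\mathbf{p}\in\mathbb{R}^n:\sum_{i=1}^n p_i\le p^{\max},\ p_i\ge 0\ \forall i\}$. States are $\omega=(e,\mathbf{s})\in\Omega$, where $e$ (harvested energy) is a real number and $\mathbf{s}$ is a device state. The random states $\omega[t]=(e[t],\mathbf{s}[t])$, $t\in\{1,2,\ldots\}$, are i.i.d. with $0\le e[t]\le e^{\max}$; $\mathbb{E}[e]=\mathbb{E}[e[t]]$. For each $\omega\in\Omega$, the utility $U(\cdot;\omega):\mathcal{P}\to\mathbb{R}$ is continuous and concave. For each $\mathbf{p}\in\mathcal{P}$, $\omega\in\Omega$, $\nabla_{\mathbf{p}}U(\mathbf{p};\omega)$ denotes a chosen subgradient of this concave function (the gradient if differentiable), i.e. $U(\mathbf{q};\omega)\le U(\mathbf{p};\omega)+(\nabla_{\mathbf{p}}U(\mathbf{p};\omega))^{\mathsf T}(\mathbf{q}-\mathbf{p})$ for all $\mathbf{q}\in\mathcal{P}$. There are constants $D_1,\ldots,D_n>0$ such that the $i$-th component of $\nabla_{\mathbf{p}}U(\mathbf{p};\omega)$ has absolute value at most $D_i$ for all $\mathbf{p}\in\mathcal{P},\omega\in\Omega$, and $D>0$ is a constant with $\|\nabla_{\mathbf{p}}U(\mathbf{p};\omega)\|\le D$ for all $\mathbf{p},\omega$ (e.g. $D=\sqrt{\sum_i D_i^2}$), $\|\cdot\|$ being the Euclidean norm. $U$ and the subgradient selection are jointly measurable and $h(\mathbf{p})=\mathbb{E}[U(\mathbf{p};\omega[t])]$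 is finite for all $\mathbf{p}\in\mathcal{P}$. Algorithm 1 (parameter $V>0$). Initialize $Q[0]=0$ and $\mathbf{p}[1]=\mathbf{0}$. At the end of each slot $t\in\{1,2,\ldots\}$, observe $\omega[t]$ and set $$Q[t]=\min\Big\{Q[t-1]+e[t]-\sum_{i=1}^n p_i[t],\,0\Big\},$$ $$\mathbf{p}[t+1]=\mathrm{Proj}_{\mathcal{P}}\Big\{\mathbf{p}[t]+\tfrac1V\nabla_{\mathbf{p}}U(\mathbf{p}[t];\omega[t])+\tfrac1{V^2}Q[t]\mathbf{1}\Big\},$$ where $\mathrm{Proj}_{\mathcal{P}}$ is Euclidean projection onto $\mathcal{P}$ and $\mathbf{1}$ is the all-ones vector. *)

(* Defs.v *)
From HB Require Import structures.
From mathcomp Require Import all_boot all_order all_algebra.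
From mathcomp Require Import all_classical all_reals all_analysis.

Set Implicit Arguments.
Unset Strict Implicit.
Unset Printing Implicit Defensive.

Import Order.TTheory GRing.Theory Num.Theory.
Import numFieldNormedType.Exports.

Local Open Scope classical_set_scope.
Local Open Scope ring_scope.

Section euclidean.
Context {R : realType} {n : nat}.
Implicit Types (u v x y p : 'rV[R]_n) (A : set 'rV[R]_n).

Definition total p : R := \sum_(i < n) p 0 i.

Definition power_set (pmax : R) : set 'rV[R]_n :=
  [set p | total p <= pmax /\ forall i, 0 <= p 0 i].

Definition dotrv u v : R := \sum_(i < n) u 0 i * v 0 i.

(* The library norm `|u| on matrices is the sup norm. *)
Definition enorm u : R := Num.sqrt (\sum_(i < n) u 0 i ^+ 2).

(* y is the Euclidean projection of x onto A. *)
Definition is_proj A x y : Prop :=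
  A y /\ forall z, A z -> enorm (x - y) <= enorm (x - z).

Definition concave_on A (f : 'rV[R]_n -> R) : Prop :=
  convex_function A (fun p => - f p).

Definition is_subgradient A (f : 'rV[R]_n -> R) p (v : 'rV[R]_n) : Prop :=
  forall q, A q -> f q <= f p + dotrv v (q - p).

End euclidean.

(* Row vectors with their Borel sigma-algebra (the library puts no measurable
   structure on matrices). *)
Definition borel_rV (R : realType) (n : nat) :=
  g_sigma_algebraType (@open 'rV[R]_n).

Section iid.
Context {d d' : measure_display} {T : measurableType d}
  {X : measurableType d'} {R : realType}.

(* Processes are indexed by the slots t >= 1; the index 0 is ignored. *)
Definition mutually_independent (P : probability T R)
    (x : nat -> {mfun T >-> X}) : Prop :=
  forall (s : seq nat) (A : nat -> set X), uniq s -> 0%N \notin s ->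
    (forall t, measurable (A t)) ->
    P (\big[setI/setT]_(t <- s) (x t @^-1` A t)) =
      (\prod_(t <- s) P (x t @^-1` A t))%E.

Definition identically_distributed (P : probability T R)
    (x : nat -> {mfun T >-> X}) : Prop :=
  forall t A, (0 < t)%N -> measurable A ->
    distribution P (x t) A = distribution P (x 1%N) A.

Definition iid (P : probability T R) (x : nat -> {mfun T >-> X}) : Prop :=
  mutually_independent P x /\ identically_distributed P x.

End iid.

Section energy_harvesting.
Context {R : realType} {n : nat} {d d' : measure_display}
  {T : measurableType d} {S : measurableType d'}.
Implicit Types (P : probability T R) (U : 'rV[R]_n -> R * S -> R)
  (omega : nat -> {mfun T >-> (R * S)%type}) (p : nat -> T -> 'rV[R]_n).

Definition mean_energy P omega : R := fine 'E_P[fun w => (omega 1%N w).1].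

(* The states being identically distributed, slot 1 stands for any slot. *)
Definition mean_utility P U omega (q : 'rV[R]_n) : R :=
  fine 'E_P[fun w => U q (omega 1%N w)].

Definition optimal_utility P U omega (pmax : R) : R :=
  sup [set mean_utility P U omega q | q in
    [set q | power_set pmax q /\ total q <= mean_energy P omega]].

(* Q and p are the sample paths produced by the algorithm with parameter V when
   g is the subgradient selection; p 0 is not part of the algorithm. *)
Record algorithm_run (pmax V : R) (g : 'rV[R]_n -> R * S -> 'rV[R]_n) omega
    (Q : nat -> T -> R) p : Prop := AlgorithmRun {
  run_Q0 : forall w, Q 0%N w = 0 ;
  run_p1 : forall w, p 1%N w = 0 ;
  run_Q : forall t w, (0 < t)%N ->
    Q t w = Num.min (Q t.-1 w + (omega t w).1 - total (p t w)) 0 ;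
  run_p : forall t w, (0 < t)%N ->
    is_proj (power_set pmax)
      (p t w + V^-1 *: g (p t w) (omega t w)
         + (V ^- 2 * Q t w) *: const_mx 1)
      (p t.+1 w)
}.

Definition average_utility P U omega p (t : nat) : \bar R :=
  ((t%:R^-1)%:E *
    \sum_(1 <= tau < t.+1) 'E_P[fun w => U (p tau w) (omega tau w)])%E.

End energy_harvesting.

(* Main.v *)
(* Let z be feasible. Completing the square in the projection step (strong
   concavity of its objective) and the queue drift
   Q[t+1]^2 - Q[t]^2 <= 2 Q[t] (e[t+1] - sum_i p_i[t+1]) + B
   give, for L[t] = Q[t]^2 / 2 + V^2 |z - p[t]|^2 / 2, the pathwise inequality
   V U(p[t]; w[t]) >= V U(z; w[t]) + Q[t] (sum_i z_i - e[t+1])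
                      + L[t+1] - L[t] - (B + D^2) / 2.
   Summing telescopes L, with L[1] <= V^2 pmax^2 / 2 because Q[1] = 0.  The middle
   term has nonnegative expectation: Q[t] <= 0 is a measurable function of
   w[1], ..., w[t], hence independent of e[t+1], and sum_i z_i <= E[e].
   Measurability of the iterates follows from the nonexpansiveness of the
   projection. *)
Require Import Defs.
From HB Require Import structures.
From mathcomp Require Import all_boot all_order all_algebra.
From mathcomp Require Import all_classical all_reals all_analysis.
From mathcomp Require Import measurable_realfun ring lra.

Set Implicit Arguments.
Unset Strict Implicit.
Unset Printing Implicit Defensive.

Import Order.TTheory GRing.Theory Num.Theory.
Import numFieldNormedType.Exports.

Local Open Scope classical_set_scope.
Local Open Scope ring_scope.

Local Notation total := Defs.total.

(** * Inner product and projection onto the power set *)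

Section euclidean_geometry.
Context {R : realType} {n : nat}.
Implicit Types (u v x y z p : 'rV[R]_n) (A : set 'rV[R]_n).

Lemma dotrvC u v : dotrv u v = dotrv v u.
Proof. by apply: eq_bigr => i _; rewrite mulrC. Qed.

Lemma dotrvDl u v z : dotrv (u + v) z = dotrv u z + dotrv v z.
Proof.
by rewrite /dotrv -big_split; apply: eq_bigr => i _; rewrite mxE mulrDl.
Qed.

Lemma dotrvZl (a : R) u v : dotrv (a *: u) v = a * dotrv u v.
Proof. by rewrite /dotrv mulr_sumr; apply: eq_bigr => i _; rewrite mxE mulrA. Qed.

Lemma dotrvNl u v : dotrv (- u) v = - dotrv u v.
Proof. by rewrite -scaleN1r dotrvZl mulN1r. Qed.

Lemma dotrvDr z u v : dotrv z (u + v) = dotrv z u + dotrv z v.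
Proof. by rewrite dotrvC dotrvDl !(dotrvC _ z). Qed.

Lemma dotrvZr (a : R) u v : dotrv u (a *: v) = a * dotrv u v.
Proof. by rewrite dotrvC dotrvZl dotrvC. Qed.

Lemma dotrvNr u v : dotrv u (- v) = - dotrv u v.
Proof. by rewrite dotrvC dotrvNl dotrvC. Qed.

Definition dotrvE := (dotrvDl, dotrvDr, dotrvNl, dotrvNr, dotrvZl, dotrvZr).

Lemma dotrv1l u : dotrv (const_mx 1) u = total u.
Proof. by apply: eq_bigr => i _; rewrite mxE mul1r. Qed.

Lemma dotrv_ge0 u : 0 <= dotrv u u.
Proof. by apply: sumr_ge0 => i _; rewrite -expr2 sqr_ge0. Qed.

Lemma enormE u : enorm u = Num.sqrt (dotrv u u).
Proof. by congr Num.sqrt; apply: eq_bigr => i _; rewrite expr2. Qed.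

Lemma ler_enorm u v : (enorm u <= enorm v) = (dotrv u u <= dotrv v v).
Proof. by rewrite !enormE ler_sqrt// dotrv_ge0. Qed.

Lemma totalB u v : total (u - v) = total u - total v.
Proof. by rewrite -!dotrv1l dotrvDr dotrvNr. Qed.

Lemma total0 : total (0 : 'rV[R]_n) = 0.
Proof. by rewrite /total big1// => i _; rewrite mxE. Qed.

Lemma dotrv_ge_coord u i : u 0 i ^+ 2 <= dotrv u u.
Proof.
rewrite /dotrv (bigD1 i)//= -expr2 lerDl sumr_ge0// => j _.
by rewrite -expr2 sqr_ge0.
Qed.

Lemma dotrv_young u v : `|dotrv u v| <= (dotrv u u + dotrv v v) / 2.
Proof.
have := dotrv_ge0 (u + v); have := dotrv_ge0 (u - v).
rewrite !dotrvE (dotrvC v u) ler_norml => h1 h2.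
by apply/andP; split; lra.
Qed.

(** Minimality of y against the points y + l (z - y) gives 2 <x - y, z - y> <= l |z - y|^2 for every
    l in (0, 1], and a small l excludes a positive left side. *)
Lemma is_proj_variational A x y z :
  (forall l : R, 0 < l <= 1 -> A (y + l *: (z - y))) ->
  is_proj A x y -> dotrv (x - y) (z - y) <= 0.
Proof.
move=> Aseg [_ minA].
have key l : 0 < l <= 1 ->
    2 * dotrv (x - y) (z - y) <= l * dotrv (z - y) (z - y).
  move=> l01; have /andP[l0 _] := l01.
  have := minA _ (Aseg _ l01).
  rewrite opprD addrA ler_enorm; move: (x - y) (z - y) => a b.
  rewrite !dotrvE (dotrvC b a) => h.
  rewrite -(ler_pM2l l0); move: h; set c := dotrv a b; nra.
rewrite leNgt; apply/negP; set c := dotrv _ _ => c0.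
have := dotrv_ge0 (z - y); set d := dotrv (z - y) _ in key * => d0.
(* With c the inner product and d = |z - y|^2, the choice l = c / (c + d) gives l d = c - l c < c,
   against 2 c <= l d. *)
have cd0 : 0 < c + d by lra.
have l0 : 0 < c / (c + d) by rewrite divr_gt0.
have /key : 0 < c / (c + d) <= 1 by rewrite l0/= ler_pdivrMr// mul1r lerDl.
have : c / (c + d) * (c + d) = c by rewrite mulfVK// gt_eqF.
move: (c / (c + d)) l0 => l l0 lcd h.
by have := mulr_gt0 l0 c0; move: h lcd; rewrite mulrDr -/c; lra.
Qed.

Lemma power_set_segment (pmax : R) y z l : 0 < l <= 1 ->
  power_set pmax y -> power_set pmax z -> power_set pmax (y + l *: (z - y)).
Proof.
move=> /andP[l0 l1] [ty y0] [tz z0]; split => [|i].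
  rewrite -dotrv1l dotrvDr dotrvZr !dotrv1l totalB.
  by move: ty tz; set a := total y; set b := total z; nra.
by rewrite !mxE; move: (y0 i) (z0 i); nra.
Qed.

Lemma is_proj_power_set (pmax : R) x y z :
  is_proj (power_set pmax) x y -> power_set pmax z ->
  dotrv (x - y) (z - y) <= 0.
Proof.
move=> xy Az; apply: (is_proj_variational _ xy) => l l01.
by apply: power_set_segment => //; case: xy.
Qed.

(** The two variational inequalities, each tested at the other projection, add up to |y1 - y2|^2 <=
    <x1 - x2, y1 - y2>; nonnegativity of |(x1 - x2) - (y1 - y2)|^2 finishes. *)
Lemma is_proj_nonexpansive (pmax : R) x1 x2 y1 y2 :
  is_proj (power_set pmax) x1 y1 -> is_proj (power_set pmax) x2 y2 ->
  dotrv (y1 - y2) (y1 - y2) <= dotrv (x1 - x2) (x1 - x2).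
Proof.
move=> p1 p2.
have := is_proj_power_set p1 p2.1; have := is_proj_power_set p2 p1.1.
have := dotrv_ge0 ((x1 - x2) - (y1 - y2)).
rewrite !dotrvE (dotrvC x2 x1) (dotrvC y2 y1) (dotrvC y1 x1) (dotrvC y2 x1)
  (dotrvC y1 x2) (dotrvC y2 x2).
by move=> *; lra.
Qed.

(** Nonnegative coordinates are each at most the total, so the sum of their squares is at most its
    square. This bounds the distance from the starting point 0 to any feasible point. *)
Lemma power_set_dotrv (pmax : R) y : 0 < pmax -> power_set pmax y ->
  dotrv y y <= pmax ^+ 2.
Proof.
move=> pm0 [ty y0].
have t0 : 0 <= total y by apply: sumr_ge0.
apply: (@le_trans _ _ (total y * total y)); last by nra.
rewrite {2}/total mulr_sumr; apply: ler_sum => i _; apply: ler_wpM2r => //.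
by rewrite /total (bigD1 i)//= lerDl sumr_ge0.
Qed.

Lemma power_set0 (pmax : R) : 0 < pmax -> power_set pmax (0 : 'rV[R]_n).
Proof. by move=> pm0; split => [|i]; [rewrite total0 ltW|rewrite mxE]. Qed.

(* The projection step maximizes [V <g, . - p> + Q total - V^2/2 |. - p|^2],
   which is strongly concave; Young's inequality absorbs the displacement. *)
Lemma projected_ascent_step (pmax V q : R) (g p y z : 'rV[R]_n) : 0 < V ->
  is_proj (power_set pmax) (p + V^-1 *: g + (V ^- 2 * q) *: const_mx 1) y ->
  power_set pmax z ->
  V * dotrv g (z - p) + q * (total z - total y) <=
    dotrv g g / 2 +
    V ^+ 2 / 2 * (dotrv (z - p) (z - p) - dotrv (z - y) (z - y)).
Proof.
move=> V0 py Az; have V2 : 0 < V ^+ 2 by rewrite exprn_gt0.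
have := is_proj_power_set py Az; rewrite -(pmulr_rle0 _ V2).
(* Expanding this square gives Young's inequality for V <g, y - p>. *)
have := dotrv_ge0 (g + V *: (p - y)).
have -> : p + V^-1 *: g + (V ^- 2 * q) *: const_mx 1 - y =
   (p - y) + V^-1 *: g + (V ^- 2 * q) *: const_mx 1.
  by rewrite addrAC (addrAC p).
have -> : z - p = (z - y) - (p - y) by rewrite opprB -addrA addKr.
rewrite -totalB; move: (p - y) (z - y) => a b.
rewrite !dotrvE dotrv1l (dotrvC a g) (dotrvC b a) => h1 h2.
have e : V ^+ 2 * (dotrv a b + V^-1 * dotrv g b + V ^- 2 * q * total b) =
  V ^+ 2 * dotrv a b + V * dotrv g b + q * total b by field; exact: lt0r_neq0.
by move: h2; rewrite e; lra.
Qed.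

End euclidean_geometry.

(** * Borel measurability of vector-valued maps *)

Section borel_vectors.
Context {R : realType} {n : nat} {d : measure_display} {T : measurableType d}.
Implicit Types (f x y : T -> 'rV[R]_n).

Lemma rV_ballE (u v : 'rV[R]_n) (e : R) : 0 < e ->
  ball u e v <-> forall i, `|u 0 i - v 0 i| < e.
Proof.
move=> e0; split => [[_ uv] i|uv].
  by have := uv 0 i; rewrite -ball_normE.
by split=> // i j; rewrite -ball_normE/= (ord1 i).
Qed.

Lemma open_rV_ball (A : set 'rV[R]_n) u : open A -> A u ->
  exists2 e : R, 0 < e & ball u e `<=` A.
Proof. by rewrite openE => /[apply]; rewrite /interior => /nbhs_ballP. Qed.

(** Open sets are countable unions of sup-norm balls with rational centres and radii 1/(k+1), and
    the preimage of such a ball is a finite intersection of coordinate preimages. *)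
Lemma measurable_fun_borel_rV f :
  (forall i, measurable_fun setT (fun w => f w 0 i)) ->
  measurable_fun setT (f : T -> borel_rV R n).
Proof.
move=> mf.
apply: (@measurability _ _ T (borel_rV R n) setT f open) => // _ [A oA <-].
rewrite setTI.
pose c (q : 'rV[rat]_n) : 'rV[R]_n := \row_i ratr (q 0 i).
pose I := [set qk : 'rV[rat]_n * nat | ball (c qk.1) qk.2.+1%:R^-1 `<=` A].
have -> : f @^-1` A =
    \bigcup_(qk in I) f @^-1` ball (c qk.1) (qk.2.+1%:R^-1 : R).
  apply/seteqP; split => [w Ow|w [[q k] qkA /qkA//]].
  have [e e0 eA] := open_rV_ball oA Ow.
  have e20 : 0 < e / 2 by rewrite divr_gt0.
  (* With radius r below e/2, a rational centre within r of [f w] has its r-ball inside the e-ball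
     around [f w]. *)
  have [k _ /(_ k (leqnn k)) /= ke] := near_infty_natSinv_lt (PosNum e20).
  have k0 : 0 < k.+1%:R^-1 :> R by [].
  move Er : (k.+1%:R^-1 : R) k0 ke => r k0 ke.
  have /choice[q qE] : forall i, exists q : rat,
      `|f w 0 i - ratr q| < r.
    move=> i; have [|q] := @rat_in_itvoo R (f w 0 i - r) (f w 0 i + r).
      by lra.
    rewrite in_itv/= => /andP[q1 q2]; exists q.
    by rewrite ltr_norml; apply/andP; split; lra.
  exists (\row_i q i, k); rewrite /I/= Er; last first.
    by apply/rV_ballE => // i; rewrite !mxE distrC.
  move=> v /= /(rV_ballE _ _ k0) qv; apply: eA; apply/rV_ballE => // i.
  have := qv i; rewrite !mxE => {}qv.
  rewrite -(subrKA (ratr (q i))) (le_lt_trans (ler_normD _ _))//.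
  by have := qE i; lra.
rewrite bigcup_mkcond; apply: countable_bigcupT_measurable => [|[q k]].
  exact: countableP.
case: ifP => // _; rewrite /=.
have r0 : 0 < k.+1%:R^-1 :> R by [].
move: (k.+1%:R^-1 : R) r0 => r r0.
have -> : f @^-1` ball (c q) r =
    \bigcap_i ((fun w => f w 0 i) @^-1` ball (c q 0 i) r).
  apply/seteqP; split => w /=.
    by move=> /(rV_ballE _ _ r0) h i _ /=; rewrite -ball_normE; apply: h.
  move=> h; apply/rV_ballE => // i.
  by have := h i Logic.I; rewrite /= -ball_normE.
apply: fin_bigcap_measurable => // i _; rewrite -[X in measurable X]setTI.
by apply: mf => //; apply: open_measurable; apply: ball_open.
Qed.

Lemma measurable_fun_coord i :
  measurable_fun setT (fun u : borel_rV R n => u 0 i : R).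
Proof.
apply: (measurability _ (RGenOpens.measurableE R)).
move=> _ [_ [a [b ->] <-]]; rewrite setTI; apply: sub_sigma_algebra.
have /continuousP := @coord_continuous R 1 n 0 i; apply.
exact: interval_open.
Qed.

Lemma measurable_fun_total :
  measurable_fun setT (fun u : borel_rV R n => total (u : 'rV[R]_n)).
Proof. by apply: measurable_sum => i; exact: measurable_fun_coord. Qed.

Lemma measurable_power_set (pmax : R) :
  measurable (power_set pmax : set (borel_rV R n)).
Proof.
have -> : power_set pmax =
    (fun u : borel_rV R n => total (u : 'rV[R]_n)) @^-1` `]-oo, pmax] `&`
    \bigcap_i
      ((fun u : borel_rV R n => u 0 i : R) @^-1` `[0, +oo[).
  apply/seteqP; split => u /=; rewrite in_itv /=.
    by move=> [tu u0]; split => // i _ /=; rewrite in_itv/= andbT.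
  move=> [tu u0]; split => // i.
  by have := u0 i Logic.I; rewrite /= in_itv/= andbT.
apply: measurableI.
  by rewrite -[X in measurable X]setTI; exact: measurable_fun_total.
apply: fin_bigcap_measurable => // i _.
by rewrite -[X in measurable X]setTI; exact: measurable_fun_coord.
Qed.

(* The preimage under [y] of an open set is the preimage under [x] of a union of
   balls, so no projection map defined on the whole space is needed. *)
Lemma measurable_fun_nonexpansive x y :
  (forall w w', dotrv (y w - y w') (y w - y w') <=
                dotrv (x w - x w') (x w - x w')) ->
  measurable_fun setT (x : T -> borel_rV R n) ->
  measurable_fun setT (y : T -> borel_rV R n).
Proof.
move=> xy mx.
apply: (@measurability _ _ T (borel_rV R n) setT y open) => // _ [A oA <-].
rewrite setTI.
(* The factor n + 1 converts norms: sup distance below r between values of [x] gives squared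
   Euclidean distance at most n r^2 < (n + 1)^2 r^2 between those of [y]. *)
pose I := [set wr : T * R | 0 < wr.2 /\ ball (y wr.1) (n.+1%:R * wr.2) `<=` A].
have -> : y @^-1` A = x @^-1` \bigcup_(wr in I) ball (x wr.1) wr.2.
  apply/seteqP; split => w.
    move=> /(open_rV_ball oA)[e e0 eA].
    exists (w, e / n.+1%:R); last by apply: ballxx; rewrite divr_gt0.
    split => /=; first by rewrite divr_gt0.
    by rewrite mulrC divfK// pnatr_eq0.
  move=> [[v r] [/= r0 rA] /(rV_ballE _ _ r0) vw]; apply: rA.
  have nr0 : 0 < n.+1%:R * r by rewrite mulr_gt0.
  apply/rV_ballE => // i.
  rewrite ltNge; apply/negP => h.
  have /(lerXn2r 2) := h; rewrite !nnegrE normr_ge0 (ltW nr0) => /(_ isT isT).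
  rewrite real_normK ?num_real// leNgt => /negP; apply.
  have -> : y v 0 i - y w 0 i = (y v - y w) 0 i by rewrite !mxE.
  rewrite (le_lt_trans (dotrv_ge_coord _ _))// (le_lt_trans (xy _ _))//.
  apply: (@le_lt_trans _ _ (\sum_(j < n) r ^+ 2)).
    apply: ler_sum => j _; rewrite -expr2 -[X in X <= _]real_normK ?num_real//.
    apply: lerXn2r; rewrite ?nnegrE ?(ltW r0)//.
    by have := vw j; rewrite !mxE => /ltW.
  rewrite sumr_const card_ord exprMn -[X in X < _]mulr_natl ltr_pM2r ?exprn_gt0//.
  rewrite -natrX ltr_nat (@leq_trans n.+1)// -{1}(expn1 n.+1).
  by rewrite leq_pexp2l.
rewrite -[X in measurable X]setTI; apply: mx => //.
by apply: sub_sigma_algebra; apply: bigcup_open => -[v r] [/= _ _]; exact: ball_open.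
Qed.

End borel_vectors.

(** * Independence of the next state from the past *)

Section independence.
Context {d d' : measure_display} {T : measurableType d}
  {X : measurableType d'} {R : realType}.
Variables (P : probability T R) (x : nat -> {mfun T >-> X}).

(** A pi-system generating the sigma-algebra of the states of slots 1 to t. *)
Definition past_cylinders (t : nat) : set (set T) :=
  [set \big[setI/setT]_(1 <= s < t.+1) (x s @^-1` A s) |
     A in [set A : nat -> set X | forall s, measurable (A s)]].

Lemma measurable_preimage_mfun s (A : set X) :
  measurable A -> measurable (x s @^-1` A).
Proof. by move=> mA; rewrite -[X in measurable X]setTI; exact: measurable_funPT. Qed.

Lemma past_cylinders_measurable t : past_cylinders t `<=` measurable.
Proof.
move=> _ [A mA <-]; apply: bigsetI_measurable => s _.
exact: measurable_preimage_mfun.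
Qed.

Lemma past_cylinders_setI t : setI_closed (past_cylinders t).
Proof.
move=> _ _ [A mA <-] [B mB <-]; exists (fun s => A s `&` B s) => [s|].
  exact: measurableI.
by rewrite -big_split; apply: eq_bigr => s _; rewrite preimage_setI.
Qed.

Lemma past_cylinders_setT t : past_cylinders t setT.
Proof.
exists (fun=> setT) => [s /=|]; first exact: measurableT.
by rewrite big1// => s _; rewrite preimage_setT.
Qed.

Lemma past_cylinders_preimage t s (A : set X) : (0 < s <= t)%N ->
  measurable A -> past_cylinders t (x s @^-1` A).
Proof.
move=> st mA; exists (fun k => if k == s then A else setT) => [k /=|].
  by case: ifP.
rewrite (bigD1_seq s)/= ?mem_index_iota ?iota_uniq ?ltnS// eqxx.
rewrite big1 ?setIT// => k /negPf ->.
by rewrite preimage_setT.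
Qed.

(** Pi-lambda argument: for fixed B both sides are finite measures in A, and mutual independence
    makes them agree on the cylinders. *)
Lemma independent_of_past t (A : set T) (B : set X) :
  mutually_independent P x -> <<s past_cylinders t >> A -> measurable B ->
  P (A `&` x t.+1 @^-1` B) = (P A * P (x t.+1 @^-1` B))%E.
Proof.
move=> indep pA mB; have mxB := measurable_preimage_mfun t.+1 mB.
set E := x t.+1 @^-1` B in mxB *.
have PE : P E = (fine (P E))%:E by rewrite fineK// fin_num_measure.
have r0 : 0 <= fine (P E) by rewrite fine_ge0.
have PEM C : mscale (NngNum r0) P C = (P C * P E)%E.
  by rewrite /mscale muleC [in RHS]PE.
rewrite -PEM.
rewrite -[LHS]/(mrestr P mxB A).
apply: (g_sigma_algebra_measure_unique (past_cylinders t)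
  (@past_cylinders_measurable t) (fun=> setT)) pA => //.
- by move=> _; exact: past_cylinders_setT.
- by rewrite bigcup_const//; exists 0%N.
- exact: past_cylinders_setI.
- move=> _ [C mC <-]; rewrite [RHS]PEM /mrestr.
  (* [C'] agrees with [C] up to slot t and is B at slot t+1; independence over slots 1 to t+1, and
     again over 1 to t, then factors out the last event. *)
  pose C' s := if s == t.+1 then B else C s.
  have CC' : \big[setI/setT]_(1 <= s < t.+1) (x s @^-1` C s) =
             \big[setI/setT]_(1 <= s < t.+1) (x s @^-1` C' s).
    apply: eq_big_nat => s /andP[_ st]; rewrite /C'.
    by rewrite (ltn_eqF st).
  have mC' s : measurable (C' s) by rewrite /C'; case: ifP.
  have h m : P (\big[setI/setT]_(1 <= s < m) (x s @^-1` C' s)) =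
      (\prod_(1 <= s < m) P (x s @^-1` C' s))%E.
    by apply: indep => //; [exact: iota_uniq|rewrite mem_index_iota].
  have := h t.+2; rewrite big_nat_recr//= [in RHS]big_nat_recr//= -h CC'.
  by rewrite {2 4}/C' eqxx -/E.
- by move=> _; rewrite /= /mrestr setTI PE ltry.
Qed.

End independence.

(** The joint law of (Z, Y) is the product of the marginals, since they agree on rectangles; Tonelli
    then splits the integral. *)
Lemma expectationM_ge0_independent {d : measure_display} {T : measurableType d}
    {R : realType} (P : probability T R) (Z Y : T -> R) :
  measurable_fun setT Z -> measurable_fun setT Y ->
  (forall w, 0 <= Z w) -> (forall w, 0 <= Y w) ->
  (forall A B : set R, measurable A -> measurable B ->
    P (Z @^-1` A `&` Y @^-1` B) = (P (Z @^-1` A) * P (Y @^-1` B))%E) ->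
  ('E_P[fun w => (Z w * Y w)%R] = 'E_P[Z] * 'E_P[Y])%E.
Proof.
move=> mZ mY Z0 Y0 ZY.
(* The absolute values make the integrand nonnegative on the whole plane, as Tonelli requires, and
   change nothing on the range of (Z, Y). *)
pose F (u : R * R) : \bar R := (`|u.1|%:E * `|u.2|%:E)%E.
have mabs : measurable_fun setT (fun a : R => `|a|%:E).
  by apply/measurable_EFinP; exact: normr_measurable.
have mF : measurable_fun setT F.
  by apply: emeasurable_funM; [exact: (measurableT_comp mabs measurable_fst)|
    exact: (measurableT_comp mabs measurable_snd)].
have F0 u : (0 <= F u)%E by rewrite mule_ge0.
pose Z' : {mfun T >-> R} := mfun_Sub (mem_set mZ).
pose Y' : {mfun T >-> R} := mfun_Sub (mem_set mY).
have mZY : measurable_fun setT (fun w => (Z w, Y w)).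
  exact: measurable_fun_pair.
pose ZY' : {mfun T >-> (R * R)%type} := mfun_Sub (mem_set mZY).
have prodE := product_measure_unique (m1 := distribution P Z')
  (m2 := distribution P Y') (m' := distribution P ZY').
rewrite !expectation.unlock.
transitivity (\int[distribution P ZY']_u F u)%E.
  rewrite ge0_integral_distribution//; apply: eq_integral => w _.
  by rewrite /F/= !ger0_norm.
rewrite (eq_measure_integral (distribution P Z' \x distribution P Y')%E); last first.
  by move=> A mA _; apply/esym/prodE.
rewrite fubini_tonelli1// /fubini_F/F/=.
under eq_integral => a _ do rewrite ge0_integralZl//=.
rewrite ge0_integralZr//; last 1 first.
  exact: integral_ge0.
rewrite !ge0_integral_distribution//.
by congr (_ * _)%E; apply: eq_integral => w _ /=; rewrite ger0_norm.
Qed.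

(** * Integrals under identical distribution; expectations of sums *)

Section expectation_facts.
Context {d d' : measure_display} {T : measurableType d}
  {X : measurableType d'} {R : realType}.
Implicit Types (P : probability T R) (x : nat -> {mfun T >-> X}).

(** For nonnegative f the integral depends only on the law of the state; the general case splits f
    into positive and negative parts. *)
Lemma identically_distributed_integral P x (f : X -> \bar R) t :
  identically_distributed P x -> measurable_fun setT f -> (0 < t)%N ->
  (\int[P]_w f (x t w) = \int[P]_w f (x 1%N w))%E.
Proof.
move=> same mf t0.
have ge0 F : measurable_fun setT F -> (forall y, 0 <= F y)%E ->
    (\int[P]_w (F \o x t) w = \int[P]_w (F \o x 1%N) w)%E.
  move=> mF F0; rewrite -!ge0_integral_distribution//.
  by apply: eq_measure_integral => A mA _; exact: same.
change (integral P setT (f \o x t) = integral P setT (f \o x 1%N)).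
rewrite [LHS]integralE [RHS]integralE; congr (_ - _)%E.
  by rewrite (funepos_comp f (x t)) (funepos_comp f (x 1%N)); apply: ge0 => //; exact: measurable_funepos.
by rewrite (funeneg_comp f (x t)) (funeneg_comp f (x 1%N)); apply: ge0 => //; exact: measurable_funeneg.
Qed.

Lemma identically_distributed_integrable P x (f : X -> \bar R) t :
  identically_distributed P x -> measurable_fun setT f -> (0 < t)%N ->
  P.-integrable setT (fun w => f (x 1%N w)) ->
  P.-integrable setT (fun w => f (x t w)).
Proof.
move=> same mf t0 /integrableP[_ intf]; apply/integrableP; split.
  exact: measurableT_comp.
have mabs : measurable_fun setT (fun y => `|f y|)%E by exact: measurableT_comp.
by rewrite (identically_distributed_integral same mabs).
Qed.

Lemma bounded_integrable P (f : T -> R) (M : R) : measurable_fun setT f ->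
  (forall w, `|f w| <= M) -> P.-integrable setT (EFin \o f).
Proof.
move=> mf fM; apply: (@le_integrable _ _ _ _ _ _ _ (EFin \o cst M)) => //.
- exact/measurable_EFinP.
- move=> w _ /=; rewrite lee_fin (le_trans (fM w))//.
  exact: ler_norm.
- exact: finite_measure_integrable_cst.
Qed.

(** The Lyapunov increments telescope only after summation, so the pathwise inequality to be
    integrated compares whole sums and not single terms. *)
Lemma expectation_sum_ge P (F G : nat -> T -> R) (K : R) (s : seq nat) :
  (forall k, P.-integrable setT (EFin \o F k)) ->
  (forall k, P.-integrable setT (EFin \o G k)) ->
  (forall w, \sum_(k <- s) F k w - K <= \sum_(k <- s) G k w) ->
  (\sum_(k <- s) 'E_P[F k] - K%:E <= \sum_(k <- s) 'E_P[G k])%E.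
Proof.
move=> intF intG FG; rewrite !expectation.unlock.
have intK : P.-integrable setT (cst K%:E).
  exact: (finite_measure_integrable_cst P K).
have -> : K%:E = (\int[P]_w (cst K%:E) w)%E.
  by rewrite integral_cst//= probability_setT mule1.
have intsum (H : nat -> T -> R) :
    (forall k, P.-integrable setT (EFin \o H k)) ->
    P.-integrable setT (fun w => \sum_(k <- s) (H k w)%:E)%E.
  by move=> intH; apply: (@integrable_sum _ _ _ P _ _ _ s xpredT (fun k => EFin \o H k)).
rewrite -!integral_sum// -integralB//; last exact: intsum.
apply: le_integral => //.
- by apply: integrableB => //; exact: intsum.
- exact: intsum.
- by move=> w _ /=; rewrite !sumEFin -EFinB lee_fin.
Qed.

End expectation_facts.

(** * Measurability of the queue and the iterates *)

Section algorithm_measurability.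
Context {R : realType} {n : nat} {d d' : measure_display}
  {T : measurableType d} {S : measurableType d'}.

(* The sigma-algebra of [T] is arbitrary, so that the lemma also applies to the
   one generated by the first [N] states. *)
Lemma algorithm_run_measurable (pmax V : R) (Omega : set (R * S))
    (g : 'rV[R]_n -> R * S -> 'rV[R]_n) (x : nat -> T -> R * S)
    (Q : nat -> T -> R) (p : nat -> T -> 'rV[R]_n) (N : nat) :
  measurable Omega ->
  measurable_fun ((power_set pmax : set (borel_rV R n)) `*` Omega)
    (fun z => g z.1 z.2 : borel_rV R n) ->
  (forall t w, (0 < t)%N -> Omega (x t w)) ->
  (forall t, (0 < t <= N)%N -> measurable_fun setT (x t)) ->
  (forall w, Q 0%N w = 0) -> (forall w, p 1%N w = 0) ->
  (forall t w, (0 < t)%N ->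
    Q t w = Num.min (Q t.-1 w + (x t w).1 - total (p t w)) 0) ->
  (forall t w, (0 < t)%N -> power_set pmax (p t w)) ->
  (forall t w, (0 < t)%N ->
    is_proj (power_set pmax)
      (p t w + V^-1 *: g (p t w) (x t w) + (V ^- 2 * Q t w) *: const_mx 1)
      (p t.+1 w)) ->
  forall t, (t <= N)%N -> measurable_fun setT (Q t) /\
    measurable_fun setT (p t.+1 : T -> borel_rV R n).
Proof.
move=> mOmega mg xOmega mx Q0 p1 QE pP pE; elim => [_|t IH tN].
  by split; [rewrite (_ : Q _ = cst 0)//; apply/funext|
    rewrite (_ : p _ = cst 0)//; apply/funext].
have {IH} [mQ mp] := IH (ltnW tN).
have mxt : measurable_fun setT (x t.+1) by exact: mx.
have mQ1 : measurable_fun setT (Q t.+1).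
  rewrite (_ : Q _ = fun w => Num.min (Q t w + (x t.+1 w).1 - total (p t.+1 w)) 0).
    apply: measurable_minr => //; apply: measurable_funB.
      by apply: measurable_funD => //; exact: (measurableT_comp measurable_fst).
    exact: (measurableT_comp measurable_fun_total mp).
  by apply/funext => w; rewrite QE.
split => //.
(* [y] is the point before projection; the next iterate depends on it nonexpansively, so it suffices
   that [y] is measurable. *)
pose y w := p t.+1 w + V^-1 *: g (p t.+1 w) (x t.+1 w)
  + (V ^- 2 * Q t.+1 w) *: const_mx 1.
apply: (measurable_fun_nonexpansive (x := y)) => [w w'|].
  by apply: (is_proj_nonexpansive (pmax := pmax)); exact: pE.
have mgt : measurable_fun setT
    (fun w => g (p t.+1 w) (x t.+1 w) : borel_rV R n).
  apply: (measurable_comp _ _ mg (measurable_fun_pair mp mxt)).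
    by apply: measurableX => //; exact: measurable_power_set.
  by move=> _ [w _ <-]; split => /=; [exact: pP|exact: xOmega].
apply: measurable_fun_borel_rV => i.
rewrite (_ : (fun w => _) = fun w => p t.+1 w 0 i
    + V^-1 * g (p t.+1 w) (x t.+1 w) 0 i + V ^- 2 * Q t.+1 w); last first.
  by apply/funext => w; rewrite !mxE mulr1.
apply: measurable_funD; last exact: measurable_funM.
apply: measurable_funD.
  exact: (measurableT_comp (measurable_fun_coord i) mp).
apply: measurable_funM => //.
exact: (measurableT_comp (measurable_fun_coord i) mgt).
Qed.

End algorithm_measurability.

(** * Pathwise Lyapunov drift of a run *)

Section harvesting_bound.
Context {R : realType} {n : nat} {d d' : measure_display}
  {T : measurableType d} {S : measurableType d'}.
Variables (P : probability T R) (pmax emax D V : R) (Omega : set (R * S))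
  (omega : nat -> {mfun T >-> (R * S)%type})
  (U : 'rV[R]_n -> R * S -> R) (g : 'rV[R]_n -> R * S -> 'rV[R]_n)
  (Q : nat -> T -> R) (p : nat -> T -> 'rV[R]_n).
Hypotheses (pmax_gt0 : 0 < pmax) (V_gt0 : 0 < V)
  (mOmega : measurable Omega) (omega_iid : iid P omega)
  (omega_Omega : forall t w, (0 < t)%N -> Omega (omega t w))
  (energy_bound : forall t w, (0 < t)%N -> 0 <= (omega t w).1 <= emax)
  (g_subgradient : forall q x, power_set pmax q -> Omega x ->
    is_subgradient (power_set pmax) (fun q' => U q' x) q (g q x))
  (g_le_D : forall q x, power_set pmax q -> Omega x -> enorm (g q x) <= D)
  (U_measurable : measurable_fun
    ((power_set pmax : set (borel_rV R n)) `*` Omega) (fun z => U z.1 z.2))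
  (g_measurable : measurable_fun
    ((power_set pmax : set (borel_rV R n)) `*` Omega)
    (fun z => g z.1 z.2 : borel_rV R n))
  (h_finite : forall q, power_set pmax q ->
    P.-integrable setT (EFin \o (fun w => U q (omega 1%N w))))
  (run : algorithm_run pmax V g omega Q p).

Let B : R := (Num.max emax pmax) ^+ 2.

Lemma run_power_set t w : (0 < t)%N -> power_set pmax (p t w).
Proof.
case: t => // -[_|t _]; first by rewrite (run_p1 run); exact: power_set0.
by have [] := run_p run w (ltn0Sn t).
Qed.

Lemma run_total t w : (0 < t)%N -> 0 <= total (p t w) <= pmax.
Proof.
by move=> /(run_power_set w)[tp p0]; rewrite tp sumr_ge0// => i _; exact: p0.
Qed.

Lemma run_Q_le0 t w : Q t w <= 0.
Proof.
case: t => [|t]; first by rewrite (run_Q0 run).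
by rewrite (run_Q run)// ge_min lexx orbT.
Qed.

(** Energy is nonnegative and at most pmax is spent per slot. This crude bound serves the
    integrability of the queue and of its product with the energy. *)
Lemma run_Q_ge t w : - (t%:R * pmax) <= Q t w.
Proof.
elim: t => [|t IH]; first by rewrite (run_Q0 run) mul0r oppr0.
have /andP[e0 _] := energy_bound w (ltn0Sn t).
have /andP[_ tp] := run_total w (ltn0Sn t).
rewrite (run_Q run)//= le_min -natr1 mulrDl mul1r; apply/andP; split.
  by move: IH; set a := t%:R * pmax; lra.
by rewrite oppr_le0 addr_ge0 ?mulr_ge0 ?(ltW pmax_gt0).
Qed.

Lemma subgradient_dotrv_le q x : power_set pmax q -> Omega x ->
  dotrv (g q x) (g q x) <= D ^+ 2.
Proof.
move=> Aq Ox; have := g_le_D Aq Ox; rewrite enormE => h.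
have s0 := sqrtr_ge0 (dotrv (g q x) (g q x)).
rewrite -(sqr_sqrtr (dotrv_ge0 (g q x))).
by apply: lerXn2r => //; rewrite nnegrE// (le_trans s0 h).
Qed.

(* The Lyapunov function whose increments telescope. *)
Let L (z : 'rV[R]_n) t w : R :=
  Q t w ^+ 2 / 2 + V ^+ 2 / 2 * dotrv (z - p t w) (z - p t w).

(** Truncation at 0 does not increase the square, and energy and total power both lie in
    [0, max(emax, pmax)], so their difference squares to at most B. *)
Lemma queue_drift t w : (0 < t)%N ->
  Q t.+1 w ^+ 2 / 2 - Q t w ^+ 2 / 2 <=
  Q t w * ((omega t.+1 w).1 - total (p t.+1 w)) + B / 2.
Proof.
move=> t0.
have /andP[e0 e1] := energy_bound w (ltn0Sn t).
have /andP[p0 p1] := run_total w (ltn0Sn t).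
rewrite (run_Q run)//=.
set e := (omega t.+1 w).1 in e0 e1 *; set s := total _ in p0 p1 *.
set q := Q t w.
have : (e - s) ^+ 2 <= B.
  rewrite /B; have : emax <= Num.max emax pmax by rewrite le_max lexx.
  have : pmax <= Num.max emax pmax by rewrite le_max lexx orbT.
  move: (Num.max emax pmax) => m m1 m2.
  have : 0 <= (m - (e - s)) * (m + (e - s)) by apply: mulr_ge0; lra.
  by lra.
have : Num.min (q + e - s) 0 ^+ 2 <= (q + e - s) ^+ 2.
  by rewrite /Num.min; case: ifP => // _; rewrite expr0n/= sqr_ge0.
by lra.
Qed.

(** The drift from slot t to t+1 carries Q[t], which is also the weight in the projection producing
    p[t+1]; adding the two inequalities cancels [Q t w * total (p t.+1 w)]. The subgradient
    inequality turns V <g, z - p[t]> into utilities. *)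
Lemma drift_plus_penalty t w z : (0 < t)%N -> power_set pmax z ->
  V * U z (omega t w) + Q t w * (total z - (omega t.+1 w).1)
    + (L z t.+1 w - L z t w) <= V * U (p t w) (omega t w) + (B + D ^+ 2) / 2.
Proof.
move=> t0 Az; rewrite /L.
have Ap := run_power_set w t0; have Ox := omega_Omega w t0.
have := queue_drift w t0.
have := projected_ascent_step V_gt0 (run_p run w t0) Az.
have := subgradient_dotrv_le Ap Ox.
have := g_subgradient Ap Ox Az; rewrite -(ler_pM2l V_gt0).
by lra.
Qed.

Lemma drift_plus_penalty_sum t w z : power_set pmax z ->
  \sum_(1 <= s < t.+1) (U z (omega s w)
      + V^-1 * (Q s w * (total z - (omega s.+1 w).1)))
    - (V * pmax ^+ 2 / 2 + t%:R * ((B + D ^+ 2) / (2 * V)))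
  <= \sum_(1 <= s < t.+1) U (p s w) (omega s w).
Proof.
move=> Az.
have [e0 _] := andP (energy_bound w (ltn0Sn 0)).
(* Since p[1] = 0 and e[1] >= 0, the truncation gives Q[1] = 0, so [L] at slot 1 is the distance
   term alone. *)
have Q1 : Q 1%N w = 0.
  rewrite (run_Q run)// (run_Q0 run) (run_p1 run) total0 add0r subr0.
  exact/min_idPr.
have L1 : L z 1%N w <= V ^+ 2 * pmax ^+ 2 / 2.
  rewrite /L Q1 (run_p1 run) subr0 expr0n/= mul0r add0r mulrAC.
  have := power_set_dotrv pmax_gt0 Az.
  by rewrite -(ler_pM2l (exprn_gt0 2 V_gt0)); lra.
have L0 t' : 0 <= L z t' w.
  apply: addr_ge0; first by rewrite divr_ge0 ?sqr_ge0.
  by rewrite mulr_ge0 ?dotrv_ge0// divr_ge0 ?sqr_ge0.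
rewrite -(ler_pM2l V_gt0).
have V0 : V != 0 by rewrite gt_eqF.
have -> : V * (\sum_(1 <= s < t.+1) (U z (omega s w)
      + V^-1 * (Q s w * (total z - (omega s.+1 w).1)))
    - (V * pmax ^+ 2 / 2 + t%:R * ((B + D ^+ 2) / (2 * V)))) =
  V * (\sum_(1 <= s < t.+1) (U z (omega s w)
      + V^-1 * (Q s w * (total z - (omega s.+1 w).1))))
  - V ^+ 2 * pmax ^+ 2 / 2 - t%:R * ((B + D ^+ 2) / 2) by field.
(* The induction keeps the increment of [L]; afterwards [L] at slot t+1 is dropped as nonnegative
   and [L] at slot 1 is bounded by [L1]. *)
suff : V * (\sum_(1 <= s < t.+1) (U z (omega s w)
      + V^-1 * (Q s w * (total z - (omega s.+1 w).1))))
    + (L z t.+1 w - L z 1%N w) <=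
    V * (\sum_(1 <= s < t.+1) U (p s w) (omega s w))
    + t%:R * ((B + D ^+ 2) / 2).
  by have := L0 t.+1; move: L1; lra.
elim: t => [|t IH]; first by rewrite !big_geq// !mulr0 mul0r subrr addr0.
rewrite [X in V * X + _ <= _]big_nat_recr//= [X in _ <= V * X + _]big_nat_recr//=.
rewrite mulrDr [V * (U z _ + _)]mulrDr mulVKf// [in leRHS]mulrDr.
rewrite -natr1 [(_ + 1) * _]mulrDl mul1r.
by have := drift_plus_penalty w (ltn0Sn t) Az; move: IH; lra.
Qed.

(** * Measurability, integrability and expectations along a run *)

Lemma run_measurable t : measurable_fun setT (Q t) /\
  measurable_fun setT (p t.+1 : T -> borel_rV R n).
Proof.
apply: (algorithm_run_measurable (N := t) mOmega g_measurable omega_Omega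
  _ (run_Q0 run) (run_p1 run) (run_Q run) run_power_set (run_p run)) => //.
Qed.

(** The run up to slot t is built from the first t states, so the measurability lemma is applied
    with [T] carrying the sigma-algebra they generate. *)
Lemma queue_past_measurable t :
  measurable_fun setT (Q t : g_sigma_algebraType (past_cylinders omega t) -> R).
Proof.
have := @algorithm_run_measurable R n _ _
  (g_sigma_algebraType (past_cylinders omega t)) S pmax V Omega g
  (fun s => omega s) Q p t mOmega g_measurable omega_Omega.
move=> /(_ _ (run_Q0 run) (run_p1 run) (run_Q run) run_power_set (run_p run)).
move=> h; apply: (h _ t (leqnn t)).1 => s st _ A mA; rewrite setTI.
by apply: sub_sigma_algebra; exact: past_cylinders_preimage.
Qed.

Lemma energy_measurable t : measurable_fun setT (fun w => (omega t w).1).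
Proof. exact: (measurableT_comp measurable_fst). Qed.

Lemma energy_abs_le t w : (0 < t)%N -> `|(omega t w).1| <= emax.
Proof. by move=> /(energy_bound w)/andP[e0 e1]; rewrite ger0_norm. Qed.

Lemma energy_integrable t : (0 < t)%N ->
  P.-integrable setT (fun w => (omega t w).1%:E).
Proof.
move=> t0; apply: (@bounded_integrable _ _ _ P _ emax).
  exact: energy_measurable.
by move=> w; exact: energy_abs_le.
Qed.

Lemma energy_expectation t : (0 < t)%N ->
  ('E_P[fun w => (omega t w).1] = (mean_energy P omega)%:E)%E.
Proof.
move=> t0; rewrite /mean_energy fineK.
  rewrite !expectation.unlock.
  apply: (identically_distributed_integral (f := fun y => y.1%:E)) => //.
    by case: omega_iid.
  by apply/measurable_EFinP; exact: measurable_fst.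
by rewrite expectation.unlock; apply: integrable_fin_num => //; exact: energy_integrable.
Qed.

Lemma mean_energy_ge0 : 0 <= mean_energy P omega.
Proof.
rewrite /mean_energy fine_ge0// expectation.unlock; apply: integral_ge0 => w _.
by rewrite lee_fin; have /andP[] := energy_bound w (ltn0Sn 0).
Qed.

Lemma queue_abs_le t w : `|Q t w| <= t%:R * pmax.
Proof. by rewrite ler0_norm ?run_Q_le0// lerNl; exact: run_Q_ge. Qed.

Lemma queue_integrable t : P.-integrable setT (EFin \o Q t).
Proof.
apply: (@bounded_integrable _ _ _ P _ (t%:R * pmax)) (queue_abs_le t).
by have [] := run_measurable t.
Qed.

Lemma queue_energy_integrable t :
  P.-integrable setT (fun w => (Q t w * (omega t.+1 w).1)%:E).
Proof.
apply: (@bounded_integrable _ _ _ P _ (t%:R * pmax * emax)).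
  by apply: measurable_funM; [have [] := run_measurable t|exact: energy_measurable].
by move=> w; rewrite normrM ler_pM// ?queue_abs_le ?energy_abs_le.
Qed.

(** The product formula asks for nonnegative factors, so it is applied to -Q[t], which is measurable
    for the past, and to e[t+1], which is independent of it; linearity removes the sign. *)
Lemma expectation_queue_energy t :
  ('E_P[fun w => (Q t w * (omega t.+1 w).1)%R]
    = 'E_P[Q t] * (mean_energy P omega)%:E)%E.
Proof.
have [mQ _] := run_measurable t.
have := @expectationM_ge0_independent _ _ _ P (fun w => - Q t w)
  (fun w => (omega t.+1 w).1) (measurable_funN mQ) (energy_measurable _).
rewrite energy_expectation// => h.
have {h} : ('E_P[fun w => (- Q t w * (omega t.+1 w).1)%R]
    = 'E_P[fun w => (- Q t w)%R] * (mean_energy P omega)%:E)%E.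
  apply: h => [w|w|A C mA mC]; first by rewrite oppr_ge0 run_Q_le0.
    by have /andP[] := energy_bound w (ltn0Sn t).
  apply: (independent_of_past (B := fst @^-1` C)).
  - by case: omega_iid.
  - have := measurable_funN (@queue_past_measurable t).
    by move=> /(_ measurableT _ mA); rewrite setTI.
  - by rewrite -[X in measurable X]setTI; exact: measurable_fst.
have EN f : P.-integrable setT (EFin \o f) ->
    ('E_P[fun w => (- f w)%R] = - 'E_P[f])%E.
  by move=> intf; rewrite !expectation.unlock -integralN//; exact: integrable_add_def.
rewrite EN; last exact: queue_integrable.
under eq_fun do rewrite mulNr.
rewrite EN; last exact: queue_energy_integrable.
by rewrite mulNe => /oppe_inj.
Qed.

(** Measurability of U(z; .) is given on [Omega] only; extended by a default value elsewhere, it is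
    measurable everywhere and unchanged along the states. *)
Lemma fixed_utility_measurable z : power_set pmax z ->
  measurable_fun setT ((EFin \o U z) \_ Omega).
Proof.
move=> Az; apply/(measurable_restrictT _ mOmega)/measurable_EFinP.
have mz : measurable_fun Omega (fun x : R * S => (z : borel_rV R n, x)).
  by apply: measurable_funTS; exact: pair1_measurable.
apply: (measurable_comp _ _ U_measurable mz).
  by apply: measurableX => //; exact: measurable_power_set.
by move=> _ [x Ox <-].
Qed.

Lemma fixed_utilityE z t : (0 < t)%N ->
  (fun w => (U z (omega t w))%:E)
    = (fun w => ((EFin \o U z) \_ Omega) (omega t w)).
Proof.
by move=> t0; apply/funext => w; rewrite patchE mem_set//; exact: omega_Omega.
Qed.

Lemma fixed_utility_integrable z t : power_set pmax z -> (0 < t)%N ->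
  P.-integrable setT (fun w => (U z (omega t w))%:E).
Proof.
move=> Az t0; rewrite fixed_utilityE//.
apply: identically_distributed_integrable => //; first by case: omega_iid.
  exact: fixed_utility_measurable.
by rewrite -fixed_utilityE//; exact: h_finite.
Qed.

Lemma fixed_utility_expectation z t : power_set pmax z -> (0 < t)%N ->
  ('E_P[fun w => U z (omega t w)] = (mean_utility P U omega z)%:E)%E.
Proof.
move=> Az t0; rewrite /mean_utility fineK.
  rewrite !expectation.unlock fixed_utilityE// fixed_utilityE//.
  apply: identically_distributed_integral => //; first by case: omega_iid.
  exact: fixed_utility_measurable.
by rewrite expectation.unlock; apply: integrable_fin_num => //; exact: h_finite.
Qed.

Lemma run_utility_measurable t : (0 < t)%N ->
  measurable_fun setT (fun w => U (p t w) (omega t w)).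
Proof.
case: t => // t _; have [_ mp] := run_measurable t.
apply: (measurable_comp _ _ U_measurable (measurable_fun_pair mp _)) => //.
  by apply: measurableX => //; exact: measurable_power_set.
by move=> _ [w _ <-]; split => /=; [exact: run_power_set|exact: omega_Omega].
Qed.

(** The subgradient inequalities at 0 and at p[t] place U(p[t]) within M of U(0); Young's inequality
    with |g|^2 <= D^2 and |p[t]|^2 <= pmax^2 yields this M. *)
Lemma run_utility_integrable t : (0 < t)%N ->
  P.-integrable setT (fun w => (U (p t w) (omega t w))%:E).
Proof.
move=> t0; have A0 := @power_set0 R n pmax pmax_gt0.
pose M := (D ^+ 2 + pmax ^+ 2) / 2.
have M0 : 0 <= M by rewrite divr_ge0// addr_ge0 ?sqr_ge0.
apply: (@le_integrable _ _ _ _ _ _ _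
  (fun w => (`|U 0 (omega t w)| + M)%:E)) => //.
- by apply/measurable_EFinP; exact: run_utility_measurable.
- move=> w _ /=; rewrite lee_fin [leRHS]ger0_norm ?addr_ge0//.
  have Ap := run_power_set w t0; have Ox := omega_Omega w t0.
  have := g_subgradient Ap Ox A0; have := g_subgradient A0 Ox Ap.
  rewrite sub0r subr0 dotrvNr.
  have := subgradient_dotrv_le A0 Ox; have := subgradient_dotrv_le Ap Ox.
  have := dotrv_young (g 0 (omega t w)) (p t w).
  have := dotrv_young (g (p t w) (omega t w)) (p t w).
  have := power_set_dotrv pmax_gt0 Ap.
  have := ler_norm (U 0 (omega t w)); have := ler_norm (- U 0 (omega t w)).
  rewrite normrN !ler_norml /M => *; apply/andP; split; lra.
under eq_fun do rewrite EFinD.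
apply: integrableD => //; last exact: (finite_measure_integrable_cst P M).
have := fixed_utility_integrable A0 t0.
by move=> /integrable_abse.
Qed.

Lemma queue_constraint_integrable t (a : R) :
  P.-integrable setT (fun w => (Q t w * (a - (omega t.+1 w).1))%:E).
Proof.
rewrite (_ : (fun w => _) = fun w =>
  (a%:E * (Q t w)%:E - (Q t w * (omega t.+1 w).1)%:E)%E).
  by apply: integrableB => //;
    [apply: integrableZl => //; exact: queue_integrable|
     exact: queue_energy_integrable].
by apply/funext => w; rewrite -EFinM -EFinB mulrBr mulrC.
Qed.

(** By independence the expectation is E[Q[t]] (a - E[e]), a product of two nonpositive numbers. *)
Lemma expectation_queue_constraint_ge0 t (a : R) : a <= mean_energy P omega ->
  (0 <= 'E_P[fun w => (Q t w * (a - (omega t.+1 w).1))%R])%E.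
Proof.
move=> am.
have -> : ('E_P[fun w => (Q t w * (a - (omega t.+1 w).1))%R] =
    a%:E * 'E_P[Q t] - 'E_P[fun w => (Q t w * (omega t.+1 w).1)%R])%E.
  rewrite !expectation.unlock -integralZl//; last exact: queue_integrable.
  rewrite -integralB//; last 2 first.
  - by apply: integrableZl => //; exact: queue_integrable.
  - exact: queue_energy_integrable.
  by apply: eq_integral => w _; rewrite -EFinM -EFinB mulrBr mulrC.
rewrite expectation_queue_energy expectation.unlock.
have : (\int[P]_w (Q t w)%:E <= 0)%E.
  rewrite -(integral0 P setT); apply: le_integral => //.
  - exact: queue_integrable.
  - exact: integrable0.
  - by move=> w _; rewrite lee_fin run_Q_le0.
have : (\int[P]_w (Q t w)%:E \is a fin_num)%E.
  by apply: integrable_fin_num => //; exact: queue_integrable.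
move=> /fineK <-; rewrite lee_fin => q0.
rewrite -!EFinM -EFinB lee_fin -(mulrC _ a) -mulrBr.
by rewrite mulr_le0// subr_le0.
Qed.

(** * Bounds on the expected average utility *)

Lemma expectation_utility_sum t z : power_set pmax z ->
  total z <= mean_energy P omega ->
  ((t%:R * mean_utility P U omega z
      - (V * pmax ^+ 2 / 2 + t%:R * ((B + D ^+ 2) / (2 * V))))%:E
   <= \sum_(1 <= s < t.+1) 'E_P[fun w => U (p s w) (omega s w)])%E.
Proof.
move=> Az zm.
have intW k : P.-integrable setT
    (fun w => (V^-1)%:E * (Q k.+1 w * (total z - (omega k.+2 w).1))%:E)%E.
  by apply: integrableZl => //; exact: queue_constraint_integrable.
have intU k := fixed_utility_integrable Az (ltn0Sn k).
(* Indexing by k = s - 1 makes every index stand for a slot s >= 1, so integrability holds for all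
   of them. *)
pose F k w := U z (omega k.+1 w)
  + V^-1 * (Q k.+1 w * (total z - (omega k.+2 w).1)).
have intF k : P.-integrable setT (EFin \o F k).
  rewrite (_ : EFin \o _ = fun w => ((U z (omega k.+1 w))%:E
    + (V^-1)%:E * (Q k.+1 w * (total z - (omega k.+2 w).1))%:E)%E)//.
  exact: integrableD.
have EF k : ((mean_utility P U omega z)%:E <= 'E_P[F k])%E.
  have -> : ('E_P[F k] = 'E_P[fun w => U z (omega k.+1 w)] + (V^-1)%:E *
      'E_P[fun w => (Q k.+1 w * (total z - (omega k.+2 w).1))%R])%E.
    rewrite !expectation.unlock -integralZl//; last first.
      exact: queue_constraint_integrable.
    by rewrite -integralD.
  rewrite fixed_utility_expectation// leeDl// mule_ge0//.
    by rewrite lee_fin invr_ge0 ltW.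
  exact: expectation_queue_constraint_ge0.
have := @expectation_sum_ge _ _ _ P F
  (fun k w => U (p k.+1 w) (omega k.+1 w))
  (V * pmax ^+ 2 / 2 + t%:R * ((B + D ^+ 2) / (2 * V))) (index_iota 0 t)
  intF (fun k => run_utility_integrable (ltn0Sn k)).
rewrite big_add1 => h; apply: le_trans (h _).
  rewrite EFinB leeB//.
  have -> : ((t%:R * mean_utility P U omega z)%:E =
      \sum_(0 <= k < t) (mean_utility P U omega z)%:E)%E.
    by rewrite sumEFin sumr_const_nat subn0 mulr_natl.
  by apply: lee_sum => k _.
move=> w; have := drift_plus_penalty_sum t w Az.
by rewrite !big_add1.
Qed.

Lemma average_utility_fin_num t : (0 < t)%N ->
  average_utility P U omega p t \is a fin_num.
Proof.
move=> t0; rewrite /average_utility fin_numM// big_add1/=.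
apply/sum_fin_numP => k _ _; rewrite expectation.unlock.
by apply: integrable_fin_num => //; exact: run_utility_integrable.
Qed.

Lemma average_utility_ge t : (0 < t)%N ->
  ((optimal_utility P U omega pmax - V * pmax ^+ 2 / (2 * t%:R)
      - (D ^+ 2 + B) / (2 * V))%:E <= average_utility P U omega p t)%E.
Proof.
move=> t0; have t0' : 0 < t%:R :> R by rewrite ltr0n.
have fa := average_utility_fin_num t0.
rewrite -(fineK fa) lee_fin lerBlDr lerBlDr.
(* The bound for each feasible z passes to the supremum; 0 is feasible because the mean energy is
   nonnegative, so the supremum is over a nonempty set. *)
apply: ge_sup.
  exists (mean_utility P U omega 0), 0 => //=; split; first exact: power_set0.
  by rewrite total0 mean_energy_ge0.
move=> _ [z [Az zm] <-]; rewrite -!lerBlDr -lee_fin fineK//.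
rewrite /average_utility muleC lee_pdivlMr// -EFinM.
apply: le_trans (expectation_utility_sum t Az zm); rewrite lee_fin.
rewrite le_eqVlt; apply/orP; left; apply/eqP.
by field; rewrite !gt_eqF.
Qed.

End harvesting_bound.

(** * Limit superior and choice of parameters *)

Lemma limn_esup_ge {R : realType} (u : (\bar R)^nat) (a c : R) :
  (forall t, (0 < t)%N -> ((a - c / t%:R)%:E <= u t)%E) ->
  (a%:E <= limn_esup u)%E.
Proof.
(* Every set [A] containing a tail has an index t with c/t at most a prescribed e > 0, so the
   supremum of u over [A] is at least a - e. *)
move=> h; apply: le_ereal_inf_tmp => _ [A [N _ NA] <-].
apply/lee_addgt0Pr => e e0.
(* Using |c| + 1 keeps the denominator positive whatever the value of c. *)
have c0 : 0 < e / (`|c| + 1) by rewrite divr_gt0// ltr_wpDl.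
have [k _ /(_ (maxn N k) (leq_maxr _ _)) /= ke] :=
  near_infty_natSinv_lt (PosNum c0).
set t := (maxn N k).+1 in ke.
have t0 : 0 < t%:R :> R by rewrite ltr0n.
rewrite -leeBlDr//; apply: (@le_trans _ _ (u t)); last first.
  apply: ereal_sup_ubound; exists t => //; apply: NA.
  by rewrite /= /t leqW// leq_maxl.
apply: le_trans (h t _) => //; rewrite -EFinB lee_fin lerD2l lerN2.
apply: (@le_trans _ _ (`|c| / t%:R)); first by rewrite ler_pM2r ?invr_gt0 ?ler_norm.
rewrite (@le_trans _ _ ((`|c| + 1) / t%:R))//.
  by rewrite ler_pM2r ?invr_gt0// lerDl.
by rewrite mulrC -ler_pdivlMr ?ltr_wpDl// ltW.
Qed.

Theorem theorem1 (R : realType) (pmax emax D : R)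
  (pmax_gt0 : 0 < pmax) (emax_gt0 : 0 < emax) (D_gt0 : 0 < D) :
  let B : R := (Num.max emax pmax) ^+ 2 in
  exists c C : R, 0 < c /\ 0 < C /\
  forall (n : nat) (n_gt0 : (0 < n)%N)
    (d d' : measure_display) (T : measurableType d) (S : measurableType d')
    (P : probability T R)
    (Omega : set (R * S)) (mOmega : measurable Omega)
    (omega : nat -> {mfun T >-> (R * S)%type})
    (omega_iid : iid P omega)
    (omega_Omega : forall t w, (0 < t)%N -> Omega (omega t w))
    (energy_bound : forall t w, (0 < t)%N -> 0 <= (omega t w).1 <= emax)
    (U : 'rV[R]_n -> R * S -> R) (g : 'rV[R]_n -> R * S -> 'rV[R]_n)
    (U_continuous : forall x, Omega x ->
      {within power_set pmax, continuous (fun q => U q x)})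
    (U_concave : forall x, Omega x ->
      concave_on (power_set pmax) (fun q => U q x))
    (g_subgradient : forall q x, power_set pmax q -> Omega x ->
      is_subgradient (power_set pmax) (fun q' => U q' x) q (g q x))
    (Di : 'I_n -> R) (Di_gt0 : forall i, 0 < Di i)
    (g_le_Di : forall q x i, power_set pmax q -> Omega x ->
      `|g q x 0 i| <= Di i)
    (g_le_D : forall q x, power_set pmax q -> Omega x -> enorm (g q x) <= D)
    (U_measurable : measurable_fun ((power_set pmax : set (borel_rV R n)) `*` Omega)
      (fun z => U z.1 z.2))
    (g_measurable : measurable_fun ((power_set pmax : set (borel_rV R n)) `*` Omega)
      (fun z => g z.1 z.2 : borel_rV R n))
    (h_finite : forall q, power_set pmax q ->
      P.-integrable setT (EFin \o (fun w => U q (omega 1%N w))))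
    (V : R) (V_gt0 : 0 < V)
    (Q : nat -> T -> R) (p : nat -> T -> 'rV[R]_n)
    (run : algorithm_run pmax V g omega Q p),
  let Ustar := optimal_utility P U omega pmax in
  let avg := average_utility P U omega p in
  (forall t : nat, (0 < t)%N ->
     ((Ustar - V * pmax ^+ 2 / (2 * t%:R) - B / (2 * V * t%:R)
        - (D ^+ 2 + B) / (2 * V))%:E <= avg t)%E) /\
  ((Ustar - (D ^+ 2 + B) / (2 * V))%:E <= limn_esup avg)%E /\
  (forall eps : R, 0 < eps -> V = 1 / eps ->
     forall t : nat, (0 < t)%N -> c / eps ^+ 2 <= t%:R ->
     ((Ustar - C * eps)%:E <= avg t)%E).
Proof.
(* For V = 1/eps and t >= max(1, 1/eps^2), the three summands times eps dominate the three error
   terms of the finite-time bound. *)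
move=> B; exists 1, (pmax ^+ 2 / 2 + B / 2 + (D ^+ 2 + B) / 2).
have B0 : 0 <= B by exact: sqr_ge0.
split=> //; split.
  by have := exprn_gt0 2 pmax_gt0; have := exprn_gt0 2 D_gt0; move: B0; lra.
move=> n n_gt0 d d' T S P Omega mOmega omega omega_iid omega_Omega energy_bound.
move=> U g _ _ g_subgradient _ _ _ g_le_D U_measurable g_measurable h_finite.
move=> V V_gt0 Q p run Ustar avg.
have bound t (t0 : (0 < t)%N) := average_utility_ge pmax_gt0 V_gt0 mOmega
  omega_iid omega_Omega energy_bound g_subgradient g_le_D U_measurable
  g_measurable h_finite run t0.
rewrite -/B -/Ustar -/avg in bound.
(* Thanks to Q[1] = 0, [bound] has no term B/(2Vt); subtracting this nonnegative quantity gives the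
   stated form. *)
have bound' t : (0 < t)%N ->
    ((Ustar - V * pmax ^+ 2 / (2 * t%:R) - B / (2 * V * t%:R)
        - (D ^+ 2 + B) / (2 * V))%:E <= avg t)%E.
  move=> t0; apply: le_trans (bound t t0); rewrite lee_fin lerD2r lerBlDr lerDl.
  by rewrite divr_ge0// mulr_ge0// mulr_ge0// ltW.
split=> //; split.
  apply: (@limn_esup_ge _ _ _ (V * pmax ^+ 2 / 2)) => t t0.
  apply: le_trans (bound t t0); rewrite lee_fin -addrA -opprD (addrC (_ / _)) opprD addrA.
  by rewrite le_eqVlt; apply/orP; left; apply/eqP; field; rewrite !gt_eqF ?ltr0n.
move=> eps eps0 VE t t0; rewrite div1r => tc.
have tR : 0 < t%:R :> R by rewrite ltr0n.
apply: le_trans (bound t t0); rewrite lee_fin VE.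
(* This form isolates 1/(eps^2 t), which is at most 1 by the threshold on t. *)
have -> : 1 / eps * pmax ^+ 2 / (2 * t%:R) =
    pmax ^+ 2 / 2 * (eps * ((eps ^+ 2)^-1 / t%:R)).
  by field; rewrite !gt_eqF.
have -> : (D ^+ 2 + B) / (2 * (1 / eps)) = (D ^+ 2 + B) / 2 * eps.
  by field; rewrite !gt_eqF.
have : pmax ^+ 2 / 2 * (eps * ((eps ^+ 2)^-1 / t%:R)) <= pmax ^+ 2 / 2 * eps.
  rewrite ler_wpM2l ?divr_ge0 ?sqr_ge0// ler_piMr ?(ltW eps0)//.
  by rewrite ler_pdivrMr// mul1r.
have : 0 <= B * eps by rewrite mulr_ge0// ltW.
by lra.
Qed.
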